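(* Let $\mathcal{H}$ be a reproducing kernel Hilbert space on a non-empty set $\Omega$, let $T\in B(\mathcal{H})$, let $p\ge1$, let $\mu\in[0,1]$, and let $\sigma_\mu$ be an interpolation path of a symmetric mean $\sigma$. Then $$\|T\|_{\sigma_\mu\text{-ber}}^p\le\sup_{\lambda\in\Omega}\left\{\left\langle\left(|\mathcal{R}(T)|+|\mathcal{I}(T)|\right)\hat k_\lambda,\hat k_\lambda\right\rangle^p\ \sigma_\mu\ \langle T^*T\hat k_\lambda,\hat k_\lambda\rangle^{\frac p2}\right\}.$$
   Context: A reproducing kernel Hilbert space on $\Omega$ is a Hilbert space of complex-valued functions on $\Omega$ whose point evaluations are bounded; $k_\lambda$ is the reproducing kernel at $\lambda\in\Omega$ (assumed nonzero) and $\hat k_\lambda=k_\lambda/\|k_\lambda\|$. $B(\mathcal{H})$ is the algebra of bounded linear operators on $\mathcal{H}$. $\mathcal{R}(T)=\frac12(T+T^* )$ and $\mathcal{I}(T)=\frac1{2i}(T-T^* )$ are the real and imaginary parts of $T$, and $|A|=(A^*A)^{1/2}$. A mean is a continuous function $\sigma:[0,\infty)^2\to[0,\infty)$, written $a\sigma b$, monotone increasing in each variable, with $a\le a\sigma b\le b$ whenever $a\le b$, and $(\alpha a)\sigma(\alpha b)=\alpha(a\sigma b)$ for $\alpha>0$. It is symmetric if $a\sigma b=b\sigma a$. An interpolation path for a symmetric mean $\sigma$ is a family of means $\sigma_\mu$, $\mu\in[0,1]$, each increasing in each component, with $a\sigma_0b=b$, $a\sigma_1b=a$, $a\sigma_{1/2}b=a\sigma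 b$, and $(a\sigma_\mu b)\sigma(a\sigma_\nu b)=a\sigma_{\frac{\mu+\nu}2}b$ for all $\mu,\nu\in[0,1]$, $a,b\ge0$. For $p\ge1$ and $\mu\in[0,1]$, the $\sigma_\mu$-Berezin norm (depending also on $p$) is $\|T\|_{\sigma_\mu\text{-ber}}=\sup_{\lambda\in\Omega}\left(|\langle T\hat k_\lambda,\hat k_\lambda\rangle|^p\,\sigma_\mu\,\|T\hat k_\lambda\|^p\right)^{1/p}$. *)

(* Defs.v *)
From HB Require Import structures.
From mathcomp Require Import all_boot all_order all_algebra.
From mathcomp Require Import all_classical all_reals all_analysis.
From mathcomp Require Import complex.

Set Implicit Arguments.
Unset Strict Implicit.
Unset Printing Implicit Defensive.

Import Order.TTheory GRing.Theory Num.Theory.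
Import numFieldNormedType.Exports.

Local Open Scope classical_set_scope.
Local Open Scope ring_scope.
Local Open Scope complex_scope.

(* The carrier is an abstract Hilbert space over [R[i]]; its elements are made
   into functions on [Omega] by the injective linear map [fun_of], so vector
   operations are the pointwise ones. *)
Record rkhs (R : realType) (Omega : Type) := RKHS {
  carrier :> completeNormedModType R[i];
  dot : {dot carrier for @Num.conj R[i]};
  norm_dot : forall f : carrier, `|f| ^+ 2 = dot f f;
  fun_of : carrier -> Omega -> R[i];
  fun_of_linear : forall (c : R[i]) (f g : carrier) (l : Omega),
    fun_of (c *: f + g) l = c * fun_of f l + fun_of g l;
  fun_of_inj : injective fun_of;
  fun_of_bounded : forall l : Omega, exists M : R, forall f : carrier,
    `|fun_of f l| <= M%:C * `|f|
}.

Section Operators.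
Context (R : realType) (Omega : Type) (H : rkhs R Omega).
Implicit Types (T A P : H -> H) (l : Omega).

(* Norms over [R[i]] are [R[i]]-valued; they are nonnegative, so the real part
   loses nothing. *)
Definition hnorm (f : H) : R := complex.Re `|f|.

(* By the Riesz representation theorem there is exactly one such vector, as the
   evaluation at [l] is bounded; the default value [0] is never used. *)
Definition rkernel l : H :=
  xget 0 [set k : H | forall f : H, fun_of f l = dot H f k].

Definition rkernel_hat l : H := `|rkernel l|^-1 *: rkernel l.

Definition bounded_op T :=
  linear T /\ exists M : R, forall f : H, `|T f| <= M%:C * `|f|.

(* For bounded [T] the vector [adjoint T g] is again given by Riesz. *)
Definition adjoint T : H -> H := fun g =>
  xget 0 [set h : H | forall f : H, dot H (T f) g = dot H f h].

Definition re_op T : H -> H := 2^-1 *: (T + adjoint T).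
Definition im_op T : H -> H := (2 * 'i)^-1 *: (T - adjoint T).

Definition positive_op P := forall f : H, 0 <= dot H (P f) f.

(* The square root of a positive [A] in B(H): the unique positive bounded
   operator with square [A]. *)
Definition sqrt_op A : H -> H :=
  xget 0 [set P : H -> H | [/\ bounded_op P, positive_op P & P \o P = A]].

Definition abs_op A : H -> H := sqrt_op (adjoint A \o A).

(* Used where the inner product is a nonnegative real number. *)
Definition rdot (f g : H) : R := complex.Re (dot H f g).

(* [sup] is the supremum in [R]; the set is bounded for bounded [T]. *)
Definition sigma_ber_norm (s : R -> R -> R) (p : R) T : R :=
  sup [set (s (complex.Re `|dot H (T (rkernel_hat l)) (rkernel_hat l)| `^ p)
              (hnorm (T (rkernel_hat l)) `^ p)) `^ p^-1 | l in [set: Omega]].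

End Operators.

Section Means.
Context (R : realType).
Implicit Types (s : R -> R -> R) (a b : R).

(* Only the values of [s] on [0, +oo)^2 matter. *)
Record mean s : Prop := Mean {
  mean_ge0 : forall a b, 0 <= a -> 0 <= b -> 0 <= s a b;
  mean_continuous :
    {within [set x : R * R | 0 <= x.1 /\ 0 <= x.2],
      continuous (fun x : R * R => s x.1 x.2)};
  mean_monol : forall a a' b, 0 <= a -> a <= a' -> 0 <= b -> s a b <= s a' b;
  mean_monor : forall a b b', 0 <= a -> 0 <= b -> b <= b' -> s a b <= s a b';
  mean_between : forall a b, 0 <= a -> a <= b -> a <= s a b /\ s a b <= b;
  mean_homog : forall c a b, 0 < c -> 0 <= a -> 0 <= b ->
    s (c * a) (c * b) = c * s a b
}.

Definition symmetric_mean s :=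
  mean s /\ forall a b, 0 <= a -> 0 <= b -> s a b = s b a.

Record interpolation_path s (sm : R -> R -> R -> R) : Prop := InterpolationPath {
  path_mean : forall m, 0 <= m <= 1 -> mean (sm m);
  path_0 : forall a b, 0 <= a -> 0 <= b -> sm 0 a b = b;
  path_1 : forall a b, 0 <= a -> 0 <= b -> sm 1 a b = a;
  path_half : forall a b, 0 <= a -> 0 <= b -> sm 2^-1 a b = s a b;
  path_mid : forall m n a b, 0 <= m <= 1 -> 0 <= n <= 1 -> 0 <= a -> 0 <= b ->
    s (sm m a b) (sm n a b) = sm ((m + n) / 2) a b
}.

End Means.

(* Main.v *)
(* Write T = A + i B with A, B the self-adjoint parts. The pointwise bound
   |<T f, f>| <= |<A f, f>| + |<B f, f>| <= <(|A| + |B|) f, f> together with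
   |T f|^p = <T* T f, f>^(p/2) and the monotonicity of the mean gives the
   inequality under the supremum.

   The bound |<S f, f>| <= <|S| f, f> for self-adjoint S is obtained without
   spectral calculus and without uniqueness of the square root: it holds with any
   positive P such that |P f| = |S f| for all f in place of |S|. The existence of
   adjoints comes from the Riesz representation theorem, that of square roots from
   the iteration Y |-> (B + Y^2) / 2. *)
Require Import Defs.
From HB Require Import structures.
From mathcomp Require Import all_boot all_order all_algebra.
From mathcomp Require Import all_classical all_reals all_analysis.
From mathcomp Require Import complex.
From mathcomp Require Import ring lra.

Import Order.TTheory GRing.Theory Num.Theory.
Import numFieldNormedType.Exports.

Local Open Scope classical_set_scope.
Local Open Scope ring_scope.

(** * Real and complex inner products, Cauchy-Schwarz, and completeness with an explicit rate *)

Section InnerProduct.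
Set Implicit Arguments.
Unset Strict Implicit.
Local Open Scope complex_scope.
Context (R : realType) (Omega : Type) (H : rkhs R Omega).
Implicit Types (f g h : H) (a : R) (c : R[i]).

Lemma dotDl f g h : dot H (f + g) h = dot H f h + dot H g h.
Proof. exact: linearDl. Qed.

Lemma dotDr f g h : dot H h (f + g) = dot H h f + dot H h g.
Proof. exact: linearDr. Qed.

Lemma dotZl c f g : dot H (c *: f) g = c * dot H f g.
Proof. exact: linearZl_LR. Qed.

Lemma dotZr c f g : dot H f (c *: g) = Num.conj c * dot H f g.
Proof. exact: linearZr_LR. Qed.

Lemma dotBl f g h : dot H (f - g) h = dot H f h - dot H g h.
Proof. exact: linearBl. Qed.

Lemma dotBr f g h : dot H h (f - g) = dot H h f - dot H h g.
Proof. exact: linearBr. Qed.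

Lemma dotNl f g : dot H (- f) g = - dot H f g.
Proof. exact: linearNl. Qed.

Lemma dotNr f g : dot H f (- g) = - dot H f g.
Proof. exact: linearNr. Qed.

Lemma dotC f g : dot H f g = Num.conj (dot H g f).
Proof. by rewrite hermC mul1r. Qed.

Lemma rdotC f g : rdot f g = rdot g f.
Proof. by rewrite /rdot dotC; case: (dot H g f). Qed.

Lemma rdotDl f g h : rdot (f + g) h = rdot f h + rdot g h.
Proof. by rewrite /rdot dotDl raddfD. Qed.

Lemma rdotNl f g : rdot (- f) g = - rdot f g.
Proof. by rewrite /rdot dotNl raddfN. Qed.

Lemma rdotBl f g h : rdot (f - g) h = rdot f h - rdot g h.
Proof. by rewrite /rdot dotBl raddfB. Qed.

Lemma rdotZl a f g : rdot (a%:C *: f) g = a * rdot f g.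
Proof. by rewrite /rdot dotZl; case: (dot H f g) => x y /=; ring. Qed.

Lemma rdotDr f g h : rdot h (f + g) = rdot h f + rdot h g.
Proof. by rewrite !(rdotC h) rdotDl. Qed.

Lemma rdotBr f g h : rdot h (f - g) = rdot h f - rdot h g.
Proof. by rewrite !(rdotC h) rdotBl. Qed.

Lemma rdotZr a f g : rdot f (a%:C *: g) = a * rdot f g.
Proof. by rewrite !(rdotC f) rdotZl. Qed.

(* Subtraction comes first because the rules for addition match [f - g] as well. *)
Definition rdotE := (rdotBl, rdotBr, rdotDl, rdotDr, rdotZl, rdotZr).

(** Conjugate-linearity in the second slot gives [- 'i * dot H f g] for [dot H f ('i *: g)], whose
    real part is the imaginary part of [dot H f g]. Real identities thus transfer to complex
    ones. *)
Lemma dot_rdot f g : dot H f g = rdot f g +i* rdot f ('i *: g).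
Proof.
by rewrite /rdot dotZr; case: (dot H f g) => x y; congr (_ +i* _) => /=; ring.
Qed.

Lemma normE f : `|f| = (hnorm f)%:C.
Proof. by rewrite /hnorm RRe_real // ger0_real. Qed.

Lemma hnorm_ge0 f : 0 <= hnorm f.
Proof. by rewrite -lecR -normE normr_ge0. Qed.

Lemma hnorm_eq0 f : (hnorm f == 0) = (f == 0).
Proof. by rewrite -(normr_eq0 f) normE -[0 in RHS]/(0%:C) eq_complex /= eqxx andbT. Qed.

Lemma hnorm0 : hnorm (0 : H) = 0.
Proof. by apply/eqP; rewrite hnorm_eq0. Qed.

Lemma hnormD f g : hnorm (f + g) <= hnorm f + hnorm g.
Proof. by rewrite -lecR -[X in _ <= X]/(_%:C) rmorphD/= -!normE ler_normD. Qed.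

Lemma hnormN f : hnorm (- f) = hnorm f.
Proof. by rewrite /hnorm normrN. Qed.

Lemma hnormB f g : hnorm (f - g) = hnorm (g - f).
Proof. by rewrite -hnormN opprB. Qed.

Lemma hnormZc c f : hnorm (c *: f) = complex.Re `|c| * hnorm f.
Proof. by apply: complexI; rewrite rmorphM/= -!normE normrZ; congr (_ * _). Qed.

Lemma hnormZ a f : hnorm (a%:C *: f) = `|a| * hnorm f.
Proof.
apply: complexI; rewrite rmorphM/= -!normE normrZ; congr (_ * _).
by rewrite normc_def /= expr0n addr0 sqrtr_sqr.
Qed.

Lemma hnorm_sqr f : hnorm f ^+ 2 = rdot f f.
Proof.
have := norm_dot f; rewrite normE -rmorphXn /= => e.
by rewrite /rdot -e.
Qed.

Lemma hnormD_sqr f g :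
  hnorm (f + g) ^+ 2 = hnorm f ^+ 2 + 2 * rdot f g + hnorm g ^+ 2.
Proof. by rewrite !hnorm_sqr rdotDl !rdotDr (rdotC g f); ring. Qed.

Lemma hnormB_sqr f g :
  hnorm (f - g) ^+ 2 = hnorm f ^+ 2 - 2 * rdot f g + hnorm g ^+ 2.
Proof. by rewrite !hnorm_sqr rdotBl !rdotBr (rdotC g f); ring. Qed.

Lemma rdot_CS f g : `|rdot f g| <= hnorm f * hnorm g.
Proof.
have [->|g0] := eqVneq g 0.
  by rewrite -{1}(scale0r 0) -[0 : R[i]]/(0%:C) rdotZr mul0r normr0 mulr_ge0 ?hnorm_ge0.
have gp : 0 < hnorm g by rewrite lt_def hnorm_eq0 g0 hnorm_ge0.
rewrite -[leLHS]ger0_norm // -ler_sqr ?nnegrE ?mulr_ge0 ?hnorm_ge0 //.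
rewrite normr_id real_normK ?num_real // exprMn.
(* This square expands to [|g|^2 (|f|^2 |g|^2 - <f, g>^2)] with the real inner product. *)
have := sqr_ge0 (hnorm ((hnorm g ^+ 2)%:C *: f - (rdot f g)%:C *: g)).
rewrite (hnorm_sqr (_ - _)) !rdotE (rdotC g f) -!hnorm_sqr.
set x := hnorm f; set y := hnorm g; set z := rdot f g => e.
have : 0 <= y ^+ 2 * (x ^+ 2 * y ^+ 2 - z ^+ 2) by apply: le_trans e _; lra.
by rewrite pmulr_rge0 ?exprn_gt0 // subr_ge0.
Qed.

Lemma rdot_le f g : rdot f g <= hnorm f * hnorm g.
Proof. by apply: le_trans (rdot_CS f g); exact: ler_norm. Qed.

Lemma rdot_nondeg f : (forall g, rdot f g = 0) -> f = 0.
Proof.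
by move=> f0; apply/eqP; rewrite -hnorm_eq0 -sqrf_eq0 hnorm_sqr f0.
Qed.

Lemma rdot_inj f g : (forall h, rdot f h = rdot g h) -> f = g.
Proof.
move=> fg; apply/eqP; rewrite -subr_eq0; apply/eqP/rdot_nondeg => h.
by rewrite rdotBl fg subrr.
Qed.

Lemma dot_inj f g : (forall h, dot H h f = dot H h g) -> f = g.
Proof. by move=> fg; apply: rdot_inj => h; rewrite rdotC /rdot fg -/(rdot _ _) rdotC. Qed.

(** Archimedean principle; identities between limits are proved below by errors of order
    [1 / n.+1]. *)
Lemma le0_of_le_div a b : (forall n : nat, a <= b / n.+1%:R) -> a <= 0.
Proof.
move=> ab; rewrite leNgt; apply/negP => a0.
have := ab (Num.bound `|b / a|); rewrite ler_pdivlMr // leNgt => /negP; apply.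
rewrite mulrC -ltr_pdivrMr //; apply: le_lt_trans (ler_norm _) _.
by apply: lt_le_trans (archi_boundP (normr_ge0 _)) _; rewrite ler_nat.
Qed.

Lemma hnorm_complete (u : nat -> H) a :
  (forall n m, (n <= m)%N -> hnorm (u m - u n) <= a / n.+1%:R) ->
  exists l, forall n, hnorm (l - u n) <= a / n.+1%:R.
Proof.
move=> ua.
have uc : cauchy_ex (u @ \oo).
  move=> e e0.
  have er : (complex.Re e)%:C = e by rewrite RRe_real // gtr0_real.
  have {}e0 : 0 < complex.Re e by rewrite -ltcR er.
  have [n an] : exists n : nat, a / n.+1%:R < complex.Re e.
    apply: contrapT => nex.
    suff : complex.Re e <= 0 by rewrite leNgt e0.
    apply: (@le0_of_le_div _ a) => n; rewrite leNgt; apply/negP => hn.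
    by apply: nex; exists n.
  exists (u n); exists n => // m /= nm.
  rewrite -ball_normE /ball_ /= -er normE ltcR hnormB.
  exact: le_lt_trans (ua _ _ nm) an.
have /cauchy_exP/cauchy_cvgP/cvg_ex[l ul] := uc.
(* The rate survives in the limit: compare through [u (maxn n N)], which is within [1 / k.+1] of
   [l], with [k] arbitrary. *)
exists l => n; rewrite -subr_le0; apply: (@le0_of_le_div _ 1) => k.
have /cvgrPdist_lt/(_ (k.+1%:R^-1)%:C) := ul.
case=> [|N _ Nk]; first by rewrite ltcR invr_gt0 ltr0n.
have := Nk (maxn n N) (leq_maxr _ _).
rewrite /= normE ltcR => lN.
have := ua n (maxn n N) (leq_maxl _ _) => uN.
rewrite mul1r lerBlDl; have -> : l - u n = (u (maxn n N) - u n) + (l - u (maxn n N)).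
  by rewrite [RHS]addrC addrA subrK.
by apply: le_trans (hnormD _ _) (lerD uN (ltW lN)).
Qed.

End InnerProduct.

(** * Riesz representation, adjoints, and the Cartesian decomposition *)

Section Operators.
Set Implicit Arguments.
Unset Strict Implicit.
Local Open Scope complex_scope.
Context (R : realType) (Omega : Type) (H : rkhs R Omega).
Implicit Types (f g h : H) (a : R) (c : R[i]) (T : H -> H).

Lemma bounded_opP T : bounded_op T <->
  linear T /\ exists2 M, 0 < M & forall f, hnorm (T f) <= M * hnorm f.
Proof.
split=> -[lT [M]].
  move=> TM; split=> //; exists (Num.max M 1); first by rewrite lt_max ltr01 orbT.
  move=> f; apply: le_trans (ler_wpM2r (hnorm_ge0 f) (_ : M <= _)).
    by rewrite -lecR rmorphM/= -!normE.
  by rewrite le_max lexx.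
move=> M0 TM; split=> //; exists M => f.
by rewrite !normE -rmorphM/= lecR.
Qed.

Lemma linear_comb T : linear T ->
  [/\ forall f g, T (f + g) = T f + T g, forall f g, T (f - g) = T f - T g &
    forall c f, T (c *: f) = c *: T f].
Proof.
move=> lT; have T0 : T 0 = 0.
  have := lT (-1) 0 0; rewrite scaler0 addr0 => e.
  by rewrite e scaleN1r addNr.
split=> [f g|f g|c f]; first by rewrite -(scale1r f) lT !scale1r.
  by rewrite addrC -scaleN1r lT scaleN1r addrC.
by rewrite -[c *: f]addr0 lT T0 addr0.
Qed.

(** Discriminant bound, read off at [t = e / x] and [t = - e / x]. In the Riesz proof it turns near
    minimality of [J] into a near vanishing of its derivative. *)
Lemma quad_bound (x e d : R) : 0 < x -> 0 < e ->
  (forall t : R, 0 <= e ^+ 2 + 2 * t * d + t ^+ 2 * x ^+ 2) -> `|d| <= x * e.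
Proof.
move=> x0 e0 q.
have key s : s ^+ 2 = 1 -> 0 <= e * x + s * d.
  move=> s1; have := q (s * (e / x)).
  have -> : e ^+ 2 + 2 * (s * (e / x)) * d + (s * (e / x)) ^+ 2 * x ^+ 2 =
      2 * (e / x) * (e * x + s * d).
    by rewrite !exprMn s1; field; rewrite gt_eqF.
  by rewrite pmulr_rge0 // mulr_gt0 // divr_gt0.
rewrite ler_norml; apply/andP; split.
  by have := key 1 (expr1n _ 2); lra.
have s1 : (-1) ^+ 2 = 1 :> R by rewrite sqrrN expr1n.
by have := key (-1) s1; lra.
Qed.

(* Riesz representation: a minimizing sequence of the functional [|h|^2 - 2 L h]
   is Cauchy by the parallelogram law, and its limit represents [L]. *)
Lemma riesz_real (L : H -> R) (M : R) :
  (forall a f g, L (a%:C *: f + g) = a * L f + L g) ->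
  (forall f, L f <= M * hnorm f) ->
  exists h, forall f, rdot f h = L f.
Proof.
move=> Llin LM.
pose J f := hnorm f ^+ 2 - 2 * L f.
pose E := [set J f | f in [set: H]].
have EM : lbound E (- M ^+ 2).
  move=> _ [f _ <-]; rewrite /J.
  have := sqr_ge0 (hnorm f - M); have := LM f; lra.
have infE : has_inf E by split; [exists (J 0), 0 | exists (- M ^+ 2)].
pose i := inf E.
have iJ f : i <= J f by apply: (@ge_inf _ E); [exists (- M ^+ 2) | exists f].
have JD t f g : J (t%:C *: f + g) =
    t ^+ 2 * hnorm f ^+ 2 + 2 * t * (rdot f g - L f) + J g.
  by rewrite /J Llin !hnorm_sqr !rdotE (rdotC g f); ring.
(* The tolerance is a square so that distances, which enter [J] squared, get the rate [1 / n.+1]. *)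
have /choice[u uP] n : exists f, J f < i + n.+1%:R^-1 ^+ 2.
  have e0 : 0 < n.+1%:R^-1 ^+ 2 :> R by rewrite exprn_gt0 // invr_gt0 ltr0n.
  by have [_ [f _ <-] ?] := inf_adherent e0 infE; exists f.
have [h hP] : exists h, forall n, hnorm (h - u n) <= 2 / n.+1%:R.
  apply: hnorm_complete => n m nm.
  rewrite -ler_sqr ?nnegrE ?hnorm_ge0 ?mulr_ge0 ?invr_ge0 ?ler0n //.
  (* At the midpoint, [J] is the mean of [J (u m)] and [J (u n)] minus [|u m - u n|^2 / 4]; being at
     least [i], this gives [|u m - u n|^2 <= 2 (p + q) <= 4 p]. *)
  have := iJ (2^-1%:C *: (u m - u n) + u n).
  rewrite JD; have := JD 1 (u m - u n) (u n).
  rewrite scale1r subrK; have := uP n; have := uP m.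
  have : m.+1%:R^-1 ^+ 2 <= n.+1%:R^-1 ^+ 2 :> R.
    by rewrite ler_sqr ?nnegrE ?invr_ge0 ?ler0n // lef_pV2 ?posrE ?ltr0n // ler_nat.
  rewrite exprMn; move: (hnorm _ ^+ 2) (rdot _ _) (L _) => x y z.
  set p := n.+1%:R^-1 ^+ 2; set q := m.+1%:R^-1 ^+ 2; lra.
exists h => f; apply/eqP; rewrite -subr_eq0 -normr_le0.
apply: (@le0_of_le_div _ _ (3 * hnorm f)) => n.
have dn : `|rdot f (u n) - L f| <= hnorm f / n.+1%:R.
  have [f0|f0] := eqVneq f 0.
    have L0 : L 0 = 0 by have := Llin 1 0 0; rewrite scaler0 addr0; lra.
    by rewrite f0 L0 subr0 (le_trans (rdot_CS _ _)) // hnorm0 !mul0r.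
  apply: quad_bound; rewrite ?invr_gt0 ?ltr0n ?lt_def ?hnorm_eq0 ?f0 ?hnorm_ge0 // => t.
  have := iJ (t%:C *: f + u n); rewrite JD; move: (uP n).
  have lin (v w x y z : R) : w < v + x -> v <= y + z + w -> 0 <= x + z + y by clear; lra.
  exact: lin.
have -> : rdot f h - L f = rdot f (h - u n) + (rdot f (u n) - L f).
  by rewrite rdotE; ring.
apply: le_trans (ler_normD _ _) _.
have -> : 3 * hnorm f / n.+1%:R = hnorm f * (2 / n.+1%:R) + hnorm f / n.+1%:R.
  by ring.
apply: lerD dn; exact: le_trans (rdot_CS f (h - u n)) (ler_wpM2l (hnorm_ge0 f) (hP n)).
Qed.

Lemma dot_eq_re f g (x y : H) :
  rdot f g = rdot x y -> rdot f ('i *: g) = rdot x ('i *: y) ->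
  dot H f g = dot H x y.
Proof. by move=> e1 e2; rewrite !dot_rdot e1 e2. Qed.

(** Riesz for the real functional [rdot (T f) g] matches real parts; applying it to ['i *: f] as
    well matches imaginary parts. *)
Lemma adjointP T : bounded_op T ->
  forall f g, dot H (T f) g = dot H f (adjoint T g).
Proof.
move=> /bounded_opP[lT [M M0 TM]] f g; move: f.
apply: (@xgetPex _ 0 [set h | forall f, dot H (T f) g = dot H f h]).
have [TD TB TZ] := linear_comb lT.
have [||h hP] := @riesz_real (fun f => rdot (T f) g) (M * hnorm g).
- by move=> a x y; rewrite TD TZ !rdotE.
- move=> f; apply: le_trans (rdot_le _ _) _.
  by rewrite mulrAC ler_wpM2r ?hnorm_ge0.
exists h => f /=.
have irot (x y : H) : rdot x ('i *: y) = - rdot ('i *: x) y.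
  rewrite /rdot dotZr dotZl; case: (dot H x y) => r s /=; ring.
by apply: dot_eq_re; rewrite ?irot -?TZ hP.
Qed.

(** Self-adjointness phrased through the inner product alone, so that it can be used before
    boundedness is known. *)
Definition symmetric_op T := forall f g, dot H (T f) g = dot H f (T g).

Lemma symmetric_rdot T : symmetric_op T -> forall f g, rdot (T f) g = rdot f (T g).
Proof. by move=> sT f g; rewrite /rdot sT. Qed.

Lemma symmetric_dot_real T f : symmetric_op T -> dot H (T f) f = (rdot (T f) f)%:C.
Proof.
move=> sT; have := dotC (T f) f; rewrite -sT /rdot.
case: (dot H (T f) f) => x y /= [] /eqP.
by rewrite -subr_eq0 opprK -mulr2n mulrn_eq0 => /eqP->.
Qed.

Lemma adjointPr T : bounded_op T ->
  forall f g, dot H f (T g) = dot H (adjoint T f) g.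
Proof. by move=> bT f g; rewrite dotC adjointP // -dotC. Qed.

(** Linearity is inherited from the inner product by moving [T] across it; the limit [Y] of the
    iteration below becomes linear this way. *)
Lemma symmetric_linear T : symmetric_op T -> linear T.
Proof.
move=> sT c f g; apply: dot_inj => h.
by rewrite -sT !(dotDr, dotZr) -!sT.
Qed.

Lemma adjoint_linear T : bounded_op T -> linear (adjoint T).
Proof.
move=> bT c f g; apply: dot_inj => h.
by rewrite -adjointP // !(dotDr, dotZr) -!adjointP.
Qed.

(** Write [|T* f|^2 = <T T* f, f> <= M |T* f| |f|] and cancel one factor [|T* f|]. *)
Lemma adjoint_bound T M : bounded_op T -> 0 <= M ->
  (forall f, hnorm (T f) <= M * hnorm f) ->
  forall f, hnorm (adjoint T f) <= M * hnorm f.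
Proof.
move=> bT M0 TM f; have [->|a0] := eqVneq (hnorm (adjoint T f)) 0.
  by rewrite mulr_ge0 ?hnorm_ge0.
have ap : 0 < hnorm (adjoint T f) by rewrite lt_def a0 hnorm_ge0.
rewrite -(ler_pM2r ap) -expr2 hnorm_sqr /rdot -adjointP // -/(rdot _ _).
apply: le_trans (rdot_le _ _) _.
by rewrite mulrAC; apply: ler_wpM2r; rewrite ?hnorm_ge0.
Qed.

Lemma re_op_symmetric T : bounded_op T -> symmetric_op (re_op T).
Proof.
move=> bT f g; rewrite /re_op /= !(dotZl, dotZr, dotDl, dotDr) adjointP //.
rewrite -adjointPr // addrC; congr (_ * _).
by rewrite fmorphV rmorph_nat.
Qed.

Lemma im_op_symmetric T : bounded_op T -> symmetric_op (im_op T).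
Proof.
move=> bT f g; rewrite /im_op /= !(dotZl, dotZr, dotBl, dotBr) adjointP //.
(* Conjugating [2 * 'i] changes its sign, which absorbs the sign from exchanging [T] and its
   adjoint. *)
rewrite -adjointPr // -opprB mulrN -mulNr; congr (_ * _).
rewrite -invrN fmorphV; congr (_^-1).
by apply/eqP; rewrite eq_complex /=; apply/andP; split; apply/eqP; ring.
Qed.

Lemma cartesian_decomposition T f : T f = re_op T f + 'i *: im_op T f.
Proof.
have -> : re_op T f = 2^-1 *: (T f + adjoint T f) by [].
have -> : im_op T f = (2 * 'i)^-1 *: (T f - adjoint T f) by [].
rewrite scalerA; have -> : 'i * (2 * 'i)^-1 = 2^-1 :> R[i].
  by rewrite invfM mulrCA mulfV ?mulr1 // eq_complex /= oner_eq0 andbF.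
rewrite -scalerDr addrACA subrr addr0 -mulr2n -[T f *+ 2]scaler_nat scalerA.
by rewrite mulVf ?scale1r // pnatr_eq0.
Qed.

End Operators.

(** * Square roots and absolute values of operators *)

Section AbsoluteValue.
Set Implicit Arguments.
Unset Strict Implicit.
Local Open Scope complex_scope.
Context (R : realType) (Omega : Type) (H : rkhs R Omega).
Implicit Types (f g h : H) (a : R) (c : R[i]) (T S P B Y U : H -> H).

Lemma hnormi f : hnorm ('i *: f) = hnorm f.
Proof. by rewrite hnormZc normc_def /= expr0n expr1n add0r sqrtr1 mul1r. Qed.

(* The iterates of [Y |-> (B + Y^2) / 2] from 0 converge to [1 - sqrt (1 - B)];
   their increments are dominated by those of the scalar sequence with [B = 1],
   whose distance to 1 is at most [2 / (n + 2)]. *)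
Fixpoint sqrt_iter B n : H -> H :=
  if n is m.+1 then fun f => 2^-1%:C *: (B f + sqrt_iter B m (sqrt_iter B m f))
  else fun=> 0.

Fixpoint sqrt_iter1 n : R :=
  if n is m.+1 then 2^-1 * (1 + sqrt_iter1 m ^+ 2) else 0.

Lemma sqrt_iter1_bounds n :
  [/\ 0 <= sqrt_iter1 n, sqrt_iter1 n <= 1 & 1 - sqrt_iter1 n <= 2 / n.+1%:R].
Proof.
have : 0 <= sqrt_iter1 n /\ 0 <= 1 - sqrt_iter1 n <= 2 / n.+2%:R.
  elim: n => [|n [t0 /andP[t1 tn]]] /=; first by split=> //; lra.
  set t := sqrt_iter1 n in t0 t1 tn *.
  have n0 : 0 < n.+2%:R :> R by rewrite ltr0n.
  split; first by rewrite mulr_ge0 // addr_ge0 ?sqr_ge0.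
  apply/andP; split; first by nra.
  (* With [d = 1 - t] and [x = n + 2] the next distance is [d (1 - d / 2)], and [d x <= 2] gives
     [d (1 - d / 2) (x + 1) <= 2 - d^2 / 2]. *)
  rewrite ler_pdivlMr ?ltr0n // -[n.+3%:R]natr1.
  move: tn; rewrite ler_pdivlMr //; set x := n.+2%:R in n0 * => tn.
  have : (1 - t) * x * (1 + t) <= 2 * (1 + t) by apply: ler_wpM2r; lra.
  have := sqr_ge0 (1 - t). lra.
case=> t0 /andP[t1 tn]; split=> //; first by rewrite -subr_ge0.
apply: le_trans tn _; rewrite ler_pM2l // lef_pV2 ?posrE ?ltr0n // ler_nat //.
Qed.

Lemma sqrt_iter1_le n : sqrt_iter1 n <= sqrt_iter1 n.+1.
Proof. by have [? ? _] := sqrt_iter1_bounds n => /=; nra. Qed.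

(** * Convergence of the iteration for a symmetric contraction *)

Section Contraction.
Context (B : H -> H) (B_sym : symmetric_op B)
  (B_contr : forall f, hnorm (B f) <= hnorm f).

Lemma sqrt_iter_symmetric n : symmetric_op (sqrt_iter B n).
Proof.
elim: n => [|n IH] f g /=.
  by rewrite -(scale0r (0 : H)) dotZl dotZr rmorph0 !mul0r.
rewrite dotZl dotZr dotDl dotDr B_sym !IH; congr (_ * _).
exact/esym/conjc_real.
Qed.

Lemma sqrt_iter_norm n f : hnorm (sqrt_iter B n f) <= sqrt_iter1 n * hnorm f.
Proof.
elim: n f => [|n IH] f /=; first by rewrite mul0r hnorm0.
rewrite hnormZ ger0_norm ?invr_ge0 // -mulrA ler_pM2l ?invr_gt0 //.
rewrite (le_trans (hnormD _ _)) // mulrDl mul1r lerD // expr2 -mulrA.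
have [t0 _ _] := sqrt_iter1_bounds n.
by rewrite (le_trans (IH _)) // ler_wpM2l.
Qed.

(** The factorization [Z^2 - Y^2 = Z (Z - Y) + (Z - Y) Y] needs no commutativity and has the same
    form for the scalar sequence, so the induction compares term by term. *)
Lemma sqrt_iter_step n f :
  hnorm (sqrt_iter B n.+1 f - sqrt_iter B n f) <=
  (sqrt_iter1 n.+1 - sqrt_iter1 n) * hnorm f.
Proof.
elim: n f => [|n IH] f.
  rewrite subr0 subr0 (le_trans (sqrt_iter_norm _ _)) //.
have [t0 _ _] := sqrt_iter1_bounds n; have [t1 _ _] := sqrt_iter1_bounds n.+1.
have [_ YB _] := linear_comb (symmetric_linear (sqrt_iter_symmetric n.+1)).
set Y := sqrt_iter B n; set Z := sqrt_iter B n.+1 in YB *.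
have -> : sqrt_iter B n.+2 f - Z f =
    2^-1%:C *: (Z (Z f - Y f) + (Z (Y f) - Y (Y f))).
  rewrite YB -/Z addrA subrK [in X in _ - X]/Z /= -/Z -/Y -scalerBr.
  by rewrite opprD addrACA subrr add0r.
have -> : sqrt_iter1 n.+2 - sqrt_iter1 n.+1 =
    2^-1 * (sqrt_iter1 n.+1 * (sqrt_iter1 n.+1 - sqrt_iter1 n) +
            (sqrt_iter1 n.+1 - sqrt_iter1 n) * sqrt_iter1 n).
  by rewrite [sqrt_iter1 n.+2]/= -/(sqrt_iter1 n.+1) {2}[sqrt_iter1 n.+1]/=; field.
have d0 : 0 <= sqrt_iter1 n.+1 - sqrt_iter1 n by rewrite subr_ge0 sqrt_iter1_le.
rewrite hnormZ ger0_norm ?invr_ge0 // -mulrA ler_pM2l ?invr_gt0 //.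
rewrite (le_trans (hnormD _ _)) // mulrDl; apply: lerD; rewrite -mulrA.
  by rewrite (le_trans (sqrt_iter_norm _ _)) // ler_wpM2l.
rewrite (le_trans (IH _)) // ler_wpM2l //.
exact: sqrt_iter_norm.
Qed.

Lemma sqrt_iter_cauchy n m f : (n <= m)%N ->
  hnorm (sqrt_iter B m f - sqrt_iter B n f) <=
  (sqrt_iter1 m - sqrt_iter1 n) * hnorm f.
Proof.
move=> /subnK <-; elim: (m - n)%N => [|k IH].
  by rewrite add0n !subrr mul0r hnorm0.
rewrite addSn; set l := (k + n)%N in IH *.
have -> : sqrt_iter B l.+1 f - sqrt_iter B n f =
    (sqrt_iter B l.+1 f - sqrt_iter B l f) + (sqrt_iter B l f - sqrt_iter B n f).
  by rewrite addrA subrK.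
apply: le_trans (hnormD _ _) _; apply: le_trans (lerD (sqrt_iter_step l f) IH) _.
by rewrite -mulrDl addrA subrK.
Qed.

(** [Y] is the pointwise limit of the iterates; the last equation says [(1 - Y)^2 = 1 - B]. *)
Lemma half_fixpoint : exists Y, [/\ symmetric_op Y,
  forall f, hnorm (Y f) <= hnorm f & forall f, (2 : R)%:C *: Y f = B f + Y (Y f)].
Proof.
have /choice[Y YP] f : exists l, forall n,
    hnorm (l - sqrt_iter B n f) <= 2 * hnorm f / n.+1%:R.
  apply: hnorm_complete => n m nm.
  apply: le_trans (sqrt_iter_cauchy _ nm) _.
  have [_ _ tn] := sqrt_iter1_bounds n; have [_ tm _] := sqrt_iter1_bounds m.
  rewrite [leRHS]mulrAC. apply: ler_wpM2r (hnorm_ge0 f) _ _ _.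
  exact: le_trans (lerB tm (lexx _)) tn.
have Ysym : symmetric_op Y.
  (* Used for [c = 1] and [c = 'i], which yield the real and imaginary parts of the symmetry
     identity. *)
  have rsym c f g : (forall x : H, hnorm (c *: x) = hnorm x) ->
      rdot (Y f) (c *: g) = rdot f (c *: Y g).
    move=> c1; apply/eqP; rewrite -subr_eq0 -normr_le0.
    apply: (@le0_of_le_div _ _ (4 * hnorm f * hnorm g)) => n.
    have -> : rdot (Y f) (c *: g) - rdot f (c *: Y g) =
        rdot (Y f - sqrt_iter B n f) (c *: g) -
        rdot f (c *: (Y g - sqrt_iter B n g)).
      have e : rdot (sqrt_iter B n f) (c *: g) = rdot f (c *: sqrt_iter B n g).
        by rewrite /rdot !dotZr sqrt_iter_symmetric.
      by rewrite scalerBr !rdotBl !rdotBr e; ring.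
    apply: le_trans (ler_normB _ _) _.
    have -> : 4 * hnorm f * hnorm g / n.+1%:R =
        2 * hnorm f / n.+1%:R * hnorm g + hnorm f * (2 * hnorm g / n.+1%:R).
      by ring.
    apply: lerD; apply: le_trans (rdot_CS _ _) _; rewrite c1.
      by apply: ler_wpM2r; rewrite ?hnorm_ge0.
    by apply: ler_wpM2l; rewrite ?hnorm_ge0.
  move=> f g; rewrite !dot_rdot (rsym 'i); last exact: hnormi.
  rewrite -(scale1r g) rsym ?scale1r // => x; by rewrite scale1r.
exists Y; split=> // f.
  rewrite -subr_le0; apply: (@le0_of_le_div _ _ (2 * hnorm f)) => n.
  apply: le_trans (YP f n); rewrite lerBlDr.
  rewrite -{1}(subrK (sqrt_iter B n f) (Y f)); apply: le_trans (hnormD _ _) _.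
  rewrite lerD2l; apply: le_trans (sqrt_iter_norm _ _) _.
  by have [_ t1 _] := sqrt_iter1_bounds n; rewrite ler_piMl ?hnorm_ge0.
apply/eqP; rewrite -subr_eq0 -hnorm_eq0 eq_le hnorm_ge0 andbT.
apply: (@le0_of_le_div _ _ (6 * hnorm f + 2 * hnorm (Y f))) => n.
have [_ YB _] := linear_comb (symmetric_linear (sqrt_iter_symmetric n)).
(* The recursion for [sqrt_iter B n.+1] is inserted, leaving three errors that each tend to zero. *)
have -> : (2 : R)%:C *: Y f - (B f + Y (Y f)) =
    (2 : R)%:C *: (Y f - sqrt_iter B n.+1 f) +
    ((sqrt_iter B n (sqrt_iter B n f - Y f)) + (sqrt_iter B n (Y f) - Y (Y f))).
  rewrite YB subrKA /= scalerBr scalerA -rmorphM mulfV // scale1r.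
  by rewrite !opprD -!addrA; congr (_ + (_ + _)); rewrite addrA addNr add0r.
apply: le_trans (hnormD _ _) _.
have -> : (6 * hnorm f + 2 * hnorm (Y f)) / n.+1%:R =
   2 * (2 * hnorm f / n.+1%:R) + (2 * hnorm f / n.+1%:R + 2 * hnorm (Y f) / n.+1%:R).
  by ring.
apply: lerD.
  rewrite hnormZ ger0_norm // ler_wpM2l //; apply: le_trans (YP f n.+1) _.
  by rewrite ler_wpM2l ?mulr_ge0 ?hnorm_ge0 // lef_pV2 ?posrE ?ltr0n // ler_nat.
apply: le_trans (hnormD _ _) _; apply: lerD; last by rewrite hnormB.
apply: le_trans (sqrt_iter_norm _ _) _; rewrite hnormB; apply: le_trans (YP f n).
by have [_ t1 _] := sqrt_iter1_bounds n; rewrite ler_piMl ?hnorm_ge0.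
Qed.
End Contraction.

(** * Positive operators: symmetry, existence of square roots, comparison *)

Lemma positive_rdot P f : positive_op P -> 0 <= rdot (P f) f.
Proof. by move=> /(_ f); rewrite lecE => /andP[]. Qed.

(** Polarization: the form is real at [f + g], which equates imaginary parts; replacing [f] by
    ['i *: f] equates real parts. *)
Lemma positive_symmetric P : linear P -> positive_op P -> symmetric_op P.
Proof.
move=> lP Ppos; have [PD _ PZ] := linear_comb lP.
have im0 f : complex.Im (dot H (P f) f) = 0.
  by have := Ppos f; rewrite lecE => /andP[/eqP].
have imE f g : complex.Im (dot H (P f) g) = complex.Im (dot H f (P g)).
  have := im0 (f + g); rewrite PD !(dotDl, dotDr) [dot H f (P g)]dotC.
  rewrite !raddfD /= !im0; case: (dot H (P f) g) => r s; case: (dot H (P g) f) => t u /=.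
  lra.
have reE z : complex.Re z = complex.Im ('i * z) by case: z => r s /=; ring.
move=> f g; apply/eqP; rewrite eq_complex imE eqxx andbT; apply/eqP.
by rewrite !reE -!dotZl -PZ imE.
Qed.

Lemma sqrt_exists S : bounded_op S ->
  exists P, [/\ bounded_op P, positive_op P & P \o P = adjoint S \o S].
Proof.
move=> bS; have /bounded_opP[lS [M M0 SM]] := bS.
have AM := adjoint_bound bS (ltW M0) SM.
(* The factor [M ^- 2] makes [B] a contraction: with [c = M ^- 2],
   [|B f|^2 <= |f|^2 - c |S f|^2]. *)
pose B f := f - (M ^- 2)%:C *: adjoint S (S f).
have Bsym : symmetric_op B.
  move=> f g; rewrite /B dotBl dotBr dotZl dotZr -adjointP // -adjointPr //.
  by congr (_ - _ * _); exact/esym/conjc_real.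
have Bcontr f : hnorm (B f) <= hnorm f.
  rewrite -ler_sqr ?nnegrE ?hnorm_ge0 // /B hnorm_sqr rdotBl !rdotBr !rdotE -!hnorm_sqr.
  have e : rdot f (adjoint S (S f)) = hnorm (S f) ^+ 2.
    by rewrite hnorm_sqr /rdot -adjointP.
  rewrite (rdotC (adjoint S (S f)) f) e.
  have : hnorm (adjoint S (S f)) ^+ 2 <= M ^+ 2 * hnorm (S f) ^+ 2.
    by rewrite -exprMn ler_sqr ?nnegrE ?mulr_ge0 ?hnorm_ge0 // ltW.
  rewrite mulrC -ler_pdivrMr ?exprn_gt0 // mulrC => h.
  have c0 : 0 <= M ^- 2 by rewrite invr_ge0 sqr_ge0.
  have := ler_wpM2l c0 h; have := mulr_ge0 c0 (sqr_ge0 (hnorm (S f))); lra.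
have [Y [Ysym Ycontr Yfix]] := half_fixpoint Bsym Bcontr.
have [YD YB YZ] := linear_comb (symmetric_linear Ysym).
(* Since [(1 - Y)^2 = 1 - B], the square of [P] is [M^2 (1 - B)], that is [S* S]. *)
pose P f := M%:C *: (f - Y f).
have Psym : symmetric_op P.
  move=> f g; rewrite /P dotZl dotZr dotBl dotBr Ysym; congr (_ * _).
  exact/esym/conjc_real.
exists P; split.
- apply/bounded_opP; split; first exact: symmetric_linear.
  exists (2 * M) => [|f]; first by rewrite mulr_gt0.
  rewrite /P hnormZ gtr0_norm // -mulrA mulrCA ler_pM2l //.
  apply: le_trans (hnormD _ _) _; rewrite hnormN mulr_natl mulr2n.
  by rewrite lerD2l.
- move=> f; rewrite symmetric_dot_real // lecR /P !rdotE mulr_ge0 ?(ltW M0) //.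
  rewrite subr_ge0 -hnorm_sqr (le_trans (rdot_le _ _)) // expr2.
  by rewrite ler_wpM2r ?hnorm_ge0.
apply/funext => f /=; rewrite /P YZ YB -scalerBr scalerA.
have -> : f - Y f - (Y f - Y (Y f)) = (M ^- 2)%:C *: adjoint S (S f).
  have := Yfix f; rewrite rmorph_nat scaler_nat mulr2n /B => e.
  by rewrite opprB addrACA -opprD e [f - _ + _]addrAC subKr.
by rewrite scalerA -!rmorphM -expr2 divff ?scale1r // sqrf_eq0 gt_eqF.
Qed.

(** Evaluate the form at [M f - U f] and bound [<U (U f), U f>] by [M |U f|^2]. *)
Lemma positive_norm_bound U M : symmetric_op U ->
  (forall f, 0 <= rdot (U f) f) -> 0 < M -> (forall f, hnorm (U f) <= M * hnorm f) ->
  forall f, hnorm (U f) ^+ 2 <= M * rdot (U f) f.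
Proof.
move=> sU U0 M0 UM f; have [_ UB UZ] := linear_comb (symmetric_linear sU).
have := U0 (M%:C *: f - U f).
rewrite UB UZ !rdotE (symmetric_rdot sU (U f) f) -hnorm_sqr => h.
have h2 : rdot (U (U f)) (U f) <= M * hnorm (U f) ^+ 2.
  apply: le_trans (rdot_le _ _) _; rewrite expr2 mulrA.
  by rewrite ler_wpM2r ?hnorm_ge0.
rewrite -subr_ge0 -(pmulr_rge0 _ M0); lra.
Qed.

(* If [- kappa < 0] were the infimum of the spectrum of [U = P - S], then for an
   approximate eigenvector [f] we would have [S f ~ P f + kappa f], whence
   [|S f|^2 >= |P f|^2 + kappa^2 |f|^2] up to a small error. *)
Lemma rdot_le_of_norm_eq S P : bounded_op S -> bounded_op P -> symmetric_op S ->
  positive_op P -> (forall f, hnorm (P f) = hnorm (S f)) ->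
  forall f, rdot (S f) f <= rdot (P f) f.
Proof.
move=> bS /bounded_opP[lP [M M0 PM]] sS Ppos PS f.
have sP := positive_symmetric lP Ppos.
have SM g : hnorm (S g) <= M * hnorm g by rewrite -PS.
pose U g := P g - S g.
(* [adm k] says [U >= - k] with [k >= 0]. The infimum of such [k] is attained, and the claim is that
   it is 0. *)
pose adm k := 0 <= k /\ forall g, 0 <= rdot (U g) g + k * hnorm g ^+ 2.
have adm2M : adm (2 * M).
  split=> [|g]; first by rewrite mulr_ge0 // ltW.
  have : hnorm (U g) <= 2 * M * hnorm g.
    apply: le_trans (hnormD _ _) _; rewrite hnormN.
    by have := PM g; have := SM g; lra.
  move/(ler_wpM2r (hnorm_ge0 g)); have := rdot_CS (U g) g.
  rewrite ler_norml expr2 => /andP[h _]; lra.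
have infA : has_inf adm by split; [exists (2 * M) | exists 0 => k []].
pose k := inf adm.
have k0 : 0 <= k by apply: lb_le_inf => [|_ []//]; exists (2 * M).
have Qpos g : 0 <= rdot (U g) g + k * hnorm g ^+ 2.
  rewrite leNgt; apply/negP => neg.
  have g0 : 0 < hnorm g ^+ 2.
    rewrite lt_def sqr_ge0 andbT; apply/negP => g0; move: neg.
    have gz : hnorm g = 0 by apply/eqP; rewrite -sqrf_eq0.
    have := rdot_CS (U g) g; rewrite gz mulr0 normr_le0 => /eqP->.
    by rewrite expr0n mulr0 addr0 ltxx.
  have e0 : 0 < - (rdot (U g) g + k * hnorm g ^+ 2) / hnorm g ^+ 2.
    by rewrite divr_gt0 // oppr_gt0.
  have [k' [_ /(_ g) k'g]] := inf_adherent e0 infA.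
  rewrite -(ltr_pM2r g0) mulrDl divfK ?gt_eqF // -/k; lra.
suff : k = 0 by move=> kz; have := Qpos f; rewrite kz mul0r addr0 rdotBl subr_ge0.
apply/eqP; rewrite eq_le k0 andbT leNgt; apply/negP => kp.
pose Q g := U g + k%:C *: g.
have Qsym : symmetric_op Q.
  move=> g h; rewrite /Q /U dotDl dotDr dotBl dotBr sP sS dotZl dotZr.
  by congr (_ + _ * _); exact/esym/conjc_real.
have QE g : rdot (Q g) g = rdot (U g) g + k * hnorm g ^+ 2.
  by rewrite /Q !rdotE hnorm_sqr.
have K0 : 0 < 2 * M + k by rewrite addr_gt0 // mulr_gt0.
have QM g : hnorm (Q g) <= (2 * M + k) * hnorm g.
  apply: le_trans (hnormD _ _) _; rewrite hnormZ ger0_norm // mulrDl lerD2r.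
  apply: le_trans (hnormD _ _) _; rewrite hnormN.
  by have := PM g; have := SM g; lra.
have Qlow g : k ^+ 2 * hnorm g <= 2 * (M + k) * hnorm (Q g).
  have [g0|g0] := eqVneq (hnorm g) 0.
    by rewrite g0 mulr0 !mulr_ge0 ?hnorm_ge0 ?addr_ge0 // ltW.
  have gp : 0 < hnorm g by rewrite lt_def g0 hnorm_ge0.
  rewrite -(ler_pM2r gp).
  (* Here [S g = v - Q g]. Expanding [|S g|^2 = |P g|^2] and dropping the nonnegative terms
     [2 k <P g, g>] and [|Q g|^2] leaves [k^2 |g|^2 <= 2 <v, Q g>]. *)
  pose v := P g + k%:C *: g.
  have vM : hnorm v <= (M + k) * hnorm g.
    apply: le_trans (hnormD _ _) _; rewrite hnormZ ger0_norm // mulrDl.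
    by rewrite lerD2r.
  have eS : hnorm (S g) ^+ 2 = hnorm (v - Q g) ^+ 2.
    by congr (hnorm _ ^+ 2); rewrite /v /Q /U opprD addrACA subrr addr0 opprB addrC subrK.
  have ev : hnorm v ^+ 2 = hnorm (P g) ^+ 2 + 2 * k * rdot (P g) g + k ^+ 2 * hnorm g ^+ 2.
    by rewrite hnormD_sqr rdotZr hnormZ exprMn real_normK ?num_real //; ring.
  have eB : hnorm (v - Q g) ^+ 2 = hnorm v ^+ 2 - 2 * rdot v (Q g) + hnorm (Q g) ^+ 2.
    exact: hnormB_sqr.
  have h1 := le_trans (rdot_le v (Q g)) (ler_wpM2r (hnorm_ge0 (Q g)) vM).
  have h2 := mulr_ge0 (ltW kp) (positive_rdot g Ppos).
  have h3 := sqr_ge0 (hnorm (Q g)).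
  move: eS; rewrite -PS eB ev; lra.
(* Squaring [Qlow] and using [|Q g|^2 <= (2 M + k) <Q g, g>] produces this coercivity constant for
   [Q]. *)
pose d := k ^+ 4 / (4 * (M + k) ^+ 2 * (2 * M + k)).
have Mk0 : 0 < M + k by rewrite addr_gt0.
have d0 : 0 < d by rewrite divr_gt0 ?mulr_gt0 ?exprn_gt0.
have Qcoer g : d * hnorm g ^+ 2 <= rdot (Q g) g.
  have Q0 x : 0 <= rdot (Q x) x by rewrite QE.
  have h1 := positive_norm_bound Qsym Q0 K0 QM g.
  rewrite /d mulrAC ler_pdivrMr ?mulr_gt0 ?exprn_gt0 //.
  have := Qlow g; rewrite -ler_sqr ?nnegrE ?mulr_ge0 ?hnorm_ge0 ?sqr_ge0 // ?(ltW Mk0) //.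
  have -> : rdot (Q g) g * (4 * (M + k) ^+ 2 * (2 * M + k)) =
    (2 * (M + k)) ^+ 2 * ((2 * M + k) * rdot (Q g) g) by ring.
  have -> : k ^+ 4 * hnorm g ^+ 2 = (k ^+ 2 * hnorm g) ^+ 2 by ring.
  move=> h2; apply: le_trans h2 _.
  by rewrite exprMn ler_wpM2l // sqr_ge0.
(* Coercivity of [Q = U + k] lets [k] be lowered by [d], against its minimality. *)
have : adm (Num.max 0 (k - d)).
  split=> [|g]; first by rewrite le_max lexx.
  have := Qcoer g; rewrite QE => h.
  have : (k - d) * hnorm g ^+ 2 <= Num.max 0 (k - d) * hnorm g ^+ 2.
    by rewrite ler_wpM2r ?sqr_ge0 // le_max lexx orbT.
  lra.
move/(ge_inf infA.2); rewrite -/k leNgt => /negP; apply.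
by rewrite gt_max kp ltrBlDr ltrDl.
Qed.

Lemma abs_opP S : bounded_op S -> [/\ bounded_op (abs_op S), positive_op (abs_op S) &
  abs_op S \o abs_op S = adjoint S \o S].
Proof. by move=> bS; have := xgetPex 0 (sqrt_exists bS). Qed.

(** The comparison uses [S] only through symmetry and [|P g| = |S g|], so [P = abs_op S] serves both
    [S] and [- S]. *)
Lemma rdot_abs_op S f : bounded_op S -> symmetric_op S ->
  `|rdot (S f) f| <= rdot (abs_op S f) f.
Proof.
move=> bS sS; have [bP Ppos PP] := abs_opP bS.
have sP := positive_symmetric (proj1 bP) Ppos.
have PS g : hnorm (abs_op S g) = hnorm (S g).
  apply/eqP; rewrite -(@eqrXn2 _ 2) ?hnorm_ge0 // !hnorm_sqr.
  rewrite -(symmetric_rdot sP) -[abs_op S (abs_op S g)]/((abs_op S \o abs_op S) g) PP /=.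
  by rewrite /rdot -adjointPr.
have bN : bounded_op (fun g => - S g).
  have [_ [M SM]] := bS; split; last by exists M => g; rewrite normrN.
  by move=> c g h; rewrite (proj1 bS) opprD scalerN.
have sN : symmetric_op (fun g => - S g).
  by move=> g h; rewrite dotNl dotNr sS.
have PN g : hnorm (abs_op S g) = hnorm (- S g) by rewrite hnormN.
rewrite ler_norml; apply/andP; split; last exact: rdot_le_of_norm_eq.
have := rdot_le_of_norm_eq bN bP sN Ppos PN f.
by rewrite rdotNl lerNl.
Qed.

End AbsoluteValue.

(** * The pointwise bound through real and imaginary parts *)

Section Cartesian.
Set Implicit Arguments.
Unset Strict Implicit.
Local Open Scope complex_scope.
Context (R : realType) (Omega : Type) (H : rkhs R Omega).
Implicit Types (f g h : H) (a : R) (c : R[i]) (T : H -> H).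

Lemma Re_norm_ge0 (V : normedZmodType R[i]) (x : V) : 0 <= complex.Re `|x|.
Proof. by rewrite -lecR RRe_real ?normr_real ?normr_ge0. Qed.

Lemma adjoint_bounded T : bounded_op T -> bounded_op (adjoint T).
Proof.
move=> bT; have /bounded_opP[_ [M M0 TM]] := bT.
apply/bounded_opP; split; first exact: adjoint_linear.
by exists M => //; exact: adjoint_bound (ltW M0) TM.
Qed.

(** Covers [re_op] and [im_op] together, with [c' = 1] and [c' = -1]. *)
Lemma symmetric_bounded_comb (S T U : H -> H) c c' : bounded_op S -> bounded_op T ->
  (forall f, U f = c *: (S f + c' *: T f)) -> symmetric_op U -> bounded_op U.
Proof.
move=> /bounded_opP[_ [M M0 SM]] /bounded_opP[_ [N N0 TN]] UE sU.
split; first exact: symmetric_linear.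
exists (complex.Re `|c| * (M + complex.Re `|c'| * N)) => f.
rewrite !normE -rmorphM lecR UE hnormZc -mulrA ler_wpM2l ?Re_norm_ge0 // mulrDl.
apply: le_trans (hnormD _ _) (lerD (SM f) _).
by rewrite hnormZc -mulrA ler_wpM2l ?Re_norm_ge0.
Qed.

Lemma re_op_bounded T : bounded_op T -> bounded_op (re_op T).
Proof.
move=> bT; apply: (@symmetric_bounded_comb T (adjoint T) _ 2^-1 1) => //.
- exact: adjoint_bounded.
- by move=> f; rewrite scale1r.
exact: re_op_symmetric.
Qed.

Lemma im_op_bounded T : bounded_op T -> bounded_op (im_op T).
Proof.
move=> bT; apply: (@symmetric_bounded_comb T (adjoint T) _ (2 * 'i)^-1 (-1)) => //.
- exact: adjoint_bounded.
- by move=> f; rewrite scaleN1r.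
exact: im_op_symmetric.
Qed.

Lemma norm_dot_le_abs_op T f : bounded_op T ->
  complex.Re `|dot H (T f) f| <= rdot ((abs_op (re_op T) + abs_op (im_op T)) f) f.
Proof.
move=> bT; have sA := re_op_symmetric bT; have sB := im_op_symmetric bT.
have -> : dot H (T f) f = (rdot (re_op T f) f)%:C + 'i * (rdot (im_op T f) f)%:C.
  rewrite {1}(cartesian_decomposition T f) dotDl (dotZl 'i (im_op T f)).
  by rewrite (symmetric_dot_real f sA) (symmetric_dot_real f sB).
rewrite -[leRHS]/(rdot (abs_op (re_op T) f + abs_op (im_op T) f) f) rdotDl.
apply: le_trans (lerD (rdot_abs_op f (re_op_bounded bT) sA)
                      (rdot_abs_op f (im_op_bounded bT) sB)).
have nC (x : R) : `|x%:C| = `|x|%:C.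
  by rewrite normc_def /= expr0n addr0 sqrtr_sqr.
have ni : `|'i : R[i]| = 1 by rewrite normc_def /= expr0n expr1n add0r sqrtr1.
have := ler_normD (rdot (re_op T f) f)%:C ('i * (rdot (im_op T f) f)%:C).
by rewrite normrM ni mul1r !nC -rmorphD lecE => /andP[].
Qed.

End Cartesian.

(** * Passage from the pointwise bound to suprema *)

Theorem theorem2p31 (R : realType) (Omega : Type) (Omega_neq0 : inhabited Omega)
    (H : rkhs R Omega) (kernel_neq0 : forall l : Omega, rkernel H l != 0)
    (T : H -> H) (T_bounded : bounded_op T)
    (p : R) (p_ge1 : 1 <= p)
    (sigma : R -> R -> R) (sigma_mu : R -> R -> R -> R)
    (sigma_sym : symmetric_mean sigma)
    (sigma_path : interpolation_path sigma sigma_mu)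
    (mu : R) (mu01 : 0 <= mu <= 1) :
  sigma_ber_norm (sigma_mu mu) p T `^ p <=
  sup [set sigma_mu mu
         (rdot ((abs_op (re_op T) + abs_op (im_op T)) (rkernel_hat H l))
               (rkernel_hat H l) `^ p)
         (rdot ((adjoint T \o T) (rkernel_hat H l)) (rkernel_hat H l) `^ (p / 2))
       | l in [set: Omega]].
Proof.
have s_mean := path_mean sigma_path mu01; set s := sigma_mu mu in s_mean *.
have p0 : 0 < p := lt_le_trans ltr01 p_ge1.
pose k := rkernel_hat H.
have k1 l : hnorm (k l) = 1.
  apply: complexI; rewrite -normE normrZ normfV normr_id mulVf //.
  by rewrite normr_eq0.
pose W := abs_op (re_op T) + abs_op (im_op T).
have WE f : W f = abs_op (re_op T) f + abs_op (im_op T) f by [].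
have sqrE l : rdot ((adjoint T \o T) (k l)) (k l) = hnorm (T (k l)) ^+ 2.
  by rewrite /= rdotC /rdot -adjointP // -/(rdot _ _) hnorm_sqr.
have powE l : (hnorm (T (k l)) ^+ 2) `^ (p / 2) = hnorm (T (k l)) `^ p.
  rewrite -powR_mulrn ?hnorm_ge0 // -powRrM; congr (_ `^ _).
  by rewrite mulrCA divff // mulr1.
set E := (X in _ <= sup X).
have Ele l : s (complex.Re `|dot H (T (k l)) (k l)| `^ p) (hnorm (T (k l)) `^ p) <=
    s (rdot (W (k l)) (k l) `^ p)
      (rdot ((adjoint T \o T) (k l)) (k l) `^ (p / 2)).
  rewrite sqrE powE; apply: (mean_monol s_mean); rewrite ?powR_ge0 //.
  have n0 : 0 <= complex.Re `|dot H (T (k l)) (k l)| by exact: Re_norm_ge0.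
  have := norm_dot_le_abs_op (k l) T_bounded => h.
  by rewrite ge0_ler_powR ?nnegrE ?(ltW p0) // (le_trans n0).
(* A real [sup] bounds its set only if the set is bounded; operator bounds at unit vectors and
   monotonicity of the mean supply this. *)
have E_ub : has_ubound E.
  have /bounded_opP[_ [M M0 TM]] := T_bounded.
  have [/bounded_opP[_ [M1 M10 PM1]] _ _] := abs_opP (re_op_bounded T_bounded).
  have [/bounded_opP[_ [M2 M20 PM2]] _ _] := abs_opP (im_op_bounded T_bounded).
  exists (s ((M1 + M2) `^ p) (M `^ p)) => _ [l _ <-].
  rewrite -/(k l) sqrE powE.
  have W0 : 0 <= rdot (W (k l)) (k l).
    apply: le_trans (norm_dot_le_abs_op (k l) T_bounded).
    exact: Re_norm_ge0.
  have Wle : rdot (W (k l)) (k l) <= M1 + M2.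
    apply: le_trans (rdot_le _ _) _; rewrite k1 mulr1 WE.
    apply: le_trans (hnormD _ _) (lerD _ _).
      by rewrite -[M1]mulr1 -(k1 l).
    by rewrite -[M2]mulr1 -(k1 l).
  have Tle : hnorm (T (k l)) <= M by rewrite -[M]mulr1 -(k1 l).
  apply: (@le_trans _ _ (s ((M1 + M2) `^ p) (hnorm (T (k l)) `^ p))).
    apply: (mean_monol s_mean); rewrite ?powR_ge0 //.
    by rewrite ge0_ler_powR ?nnegrE ?(ltW p0) // (le_trans W0).
  apply: (mean_monor s_mean); rewrite ?powR_ge0 //.
  by rewrite ge0_ler_powR ?nnegrE ?hnorm_ge0 ?(ltW p0) ?(ltW M0).
have sE l : s (complex.Re `|dot H (T (k l)) (k l)| `^ p) (hnorm (T (k l)) `^ p) <= sup E.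
  by apply: le_trans (Ele l) _; apply: ub_le_sup => //; exists l.
have s0 l : 0 <= s (complex.Re `|dot H (T (k l)) (k l)| `^ p) (hnorm (T (k l)) `^ p).
  by apply: (mean_ge0 s_mean); exact: powR_ge0.
(* A point of [Omega] makes both sets nonempty and both suprema nonnegative, as taking powers
   monotonically requires. *)
case: Omega_neq0 => l0.
have supE0 : 0 <= sup E := le_trans (s0 l0) (sE l0).
have ber_le : sigma_ber_norm s p T <= (sup E) `^ p^-1.
  apply: ge_sup; first by eexists; exists l0.
  move=> _ [l _ <-].
  by rewrite ge0_ler_powR ?nnegrE ?invr_ge0 ?(ltW p0) // ?s0 ?sE.
have ber_ge0 : 0 <= sigma_ber_norm s p T.
  apply: le_trans (ub_le_sup _ (_ : _ (_ `^ p^-1))); last by exists l0.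
    exact: powR_ge0.
  exists ((sup E) `^ p^-1) => _ [l _ <-].
  by rewrite ge0_ler_powR ?nnegrE ?invr_ge0 ?(ltW p0) // ?s0 ?sE.
have -> : sup E = (sup E `^ p^-1) `^ p.
  by rewrite -powRrM mulVf ?gt_eqF // powRr1.
by rewrite ge0_ler_powR ?nnegrE ?powR_ge0 ?(ltW p0).
Qed.
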